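(* Let $F:\mathbf{Pr}_2(\Omega)\to\mathbb{R}$ be a functional and let $\rho^*\in\mathbf{Pr}_2(\Omega)$ be a measure at which $F$ has a first variation $\frac{\delta F[\rho^*]}{\delta\rho}:\Omega\to\mathbb{R}$ that is differentiable in $\theta$. If $\rho^*$ satisfies the first-order critical condition $$\nabla_\theta\frac{\delta F[\rho^*]}{\delta\rho}(\theta)=0\qquad\text{for all }\theta\in\mathrm{supp}(\rho^* ),$$ then $\rho^*$ is a stationary solution of the Wasserstein gradient flow for $\min_{\rho\in\mathbf{Pr}_2(\Omega)}F[\rho]$, and likewise of the one for $\max_{\rho\in\mathbf{Pr}_2(\Omega)}F[\rho]$; that is, $\partial_t\rho^*=0$.
   Context: $\Omega\subseteq\mathbb{R}^p$, and $\mathbf{Pr}_2(\Omega)$ is the set of Borel probability measures on $\Omega$ with finite second moment, metrized by the Wasserstein-2 distance. A function $\frac{\delta F[\rho]}{\delta\rho}:\Omega\to\mathbb{R}$ is the first variation of $F$ at $\rho$ if for every finite signed Borel measure $\eta$ on $\Omega$ with $\eta(\Omega)=0$ and $\rho+\epsilon\eta\in\mathbf{Pr}_2(\Omega)$ for all sufficiently small $\epsilon>0$, one has $F[\rho+\epsilon\eta]-F[\rho]=\epsilon\int_\Omega\frac{\delta F[\rho]}{\delta\rho}(\theta)\,d\eta(\theta)+o(\epsilon)$ as $\epsilon\downarrow 0$. The Wasserstein gradient flow for minimizing $F$ is $$\partial_t\rho=\nabla_\theta\cdot\Big(\rho\,\nabla_\theta\frac{\delta F[\rho]}{\delta\rho}\Big),$$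 and for maximizing $F$ it is the same equation with the opposite sign on the right-hand side; equations are understood in the weak sense. Thus ''$\rho^*$ is a stationary solution ($\partial_t\rho^*=0$)'' means that the right-hand side vanishes weakly at $\rho^*$: $\int_\Omega\nabla\varphi(\theta)\cdot\nabla_\theta\frac{\delta F[\rho^*]}{\delta\rho}(\theta)\,d\rho^*(\theta)=0$ for every $\varphi\in C_c^\infty(\mathbb{R}^p)$. $\mathrm{supp}(\rho^* )$ is the closed support of $\rho^*$. *)

(* Defs.v *)
From HB Require Import structures.
From mathcomp Require Import all_boot all_order all_algebra.
From mathcomp Require Import all_classical all_reals all_analysis.

Set Implicit Arguments.
Unset Strict Implicit.
Unset Printing Implicit Defensive.

Import Order.TTheory GRing.Theory Num.Theory.
Import numFieldNormedType.Exports.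

Local Open Scope classical_set_scope.
Local Open Scope ring_scope.

(* The subspace Omega of R^p. A measurableType has to be pointed, whence the
   nonemptiness proof: it costs no generality, since the empty space carries
   no probability measure. *)
Definition domain (R : realType) (p : nat) (Omega : set 'rV[R]_p)
  (Omega0 : Omega !=set0) : Type := set_type Omega.

Definition dval (R : realType) (p : nat) (Omega : set 'rV[R]_p)
  (Omega0 : Omega !=set0) (x : domain Omega0) : 'rV[R]_p := sval x.

Definition domain_point (R : realType) (p : nat) (Omega : set 'rV[R]_p)
  (Omega0 : Omega !=set0) : domain Omega0 :=
  exist _ (sval (cid Omega0)) (mem_set (svalP (cid Omega0))).

HB.instance Definition _ (R : realType) (p : nat) (Omega : set 'rV[R]_p)
  (Omega0 : Omega !=set0) :=
  Topological.copy (domain Omega0) (set_type Omega).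

HB.instance Definition _ (R : realType) (p : nat) (Omega : set 'rV[R]_p)
  (Omega0 : Omega !=set0) :=
  isPointed.Build (domain Omega0) (domain_point Omega0).

HB.instance Definition _ (R : realType) (p : nat) (Omega : set 'rV[R]_p)
  (Omega0 : Omega !=set0) :=
  Measurable.copy (domain Omega0)
    (g_sigma_algebraType (@open (domain Omega0))).

Definition dotr (R : realType) (p : nat) (u v : 'rV[R]_p) : R :=
  \sum_(i < p) u ord0 i * v ord0 i.

(* Pr_2(Omega). Measures of the library are functions on all subsets, whose
   values on nonmeasurable sets are irrelevant; a functional on
   Pr_2(Omega) is one on Pr2 that ignores these values. *)
Record Pr2 (R : realType) (p : nat) (Omega : set 'rV[R]_p)
    (Omega0 : Omega !=set0) := MkPr2 {
  pr2_measure :> probability (domain Omega0) R ;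
  pr2_moment : (\int[pr2_measure]_x
    (dotr (dval x) (dval x))%:E < +oo)%E }.

(* Integral against a finite signed measure, through its Jordan
   decomposition; it does not depend on the Hahn decomposition (P, N). *)
Definition charge_integrable d (T : measurableType d) (R : realType)
  (eta : {charge set T -> \bar R}) (P N : set T)
  (PN : hahn_decomposition eta P N) (f : T -> R) : Prop :=
  (jordan_pos PN).-integrable setT (EFin \o f) /\
  (jordan_neg PN).-integrable setT (EFin \o f).

Definition charge_integral d (T : measurableType d) (R : realType)
  (eta : {charge set T -> \bar R}) (P N : set T)
  (PN : hahn_decomposition eta P N) (f : T -> R) : R :=
  Rintegral (jordan_pos PN) setT f - Rintegral (jordan_neg PN) setT f.

(* mu e stands for rho + e * eta, which is a member of Pr_2(Omega) for all
   small e > 0. The existence of the integral of f is part of the claim. *)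
Definition is_first_variation (R : realType) (p : nat) (Omega : set 'rV[R]_p)
  (Omega0 : Omega !=set0) (F : Pr2 Omega0 -> R) (rho : Pr2 Omega0)
  (f : domain Omega0 -> R) : Prop :=
  forall (eta : {charge set (domain Omega0) -> \bar R})
    (P N : set (domain Omega0)) (PN : hahn_decomposition eta P N)
    (mu : R -> Pr2 Omega0),
    eta setT = 0%E ->
    (\forall e \near 0^'+, forall A : set (domain Omega0), measurable A ->
       mu e A = (rho A + e%:E * eta A)%E) ->
    charge_integrable PN f /\
    (fun e : R => F (mu e) - F rho - e * charge_integral PN f)
      =o_ (0^'+) (fun e : R => e).

(* g is a gradient of f : Omega -> R in the Frechet sense relative to Omega
   (x tends to t inside Omega). It is the usual gradient at interior points of
   Omega; elsewhere it need not be unique. The norm of 'rV[R]_p is the sup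
   norm, which gives the same little-o as the Euclidean one. *)
Definition is_gradient (R : realType) (p : nat) (Omega : set 'rV[R]_p)
  (Omega0 : Omega !=set0) (f : domain Omega0 -> R)
  (g : domain Omega0 -> 'rV[R]_p) : Prop :=
  forall t : domain Omega0,
    (fun x => f x - f t - dotr (g t) (dval x - dval t))
      =o_ (nbhs t) (fun x => dval x - dval t).

(* The part of the closed support lying in Omega, where f and its gradient are
   defined. *)
Definition msupp (R : realType) (p : nat) (Omega : set 'rV[R]_p)
  (Omega0 : Omega !=set0) (rho : Pr2 Omega0) : set (domain Omega0) :=
  [set t | forall U : set (domain Omega0), open U -> U t -> (0 < rho U)%E].

Definition partial (R : realType) (p : nat) (i : 'I_p) (phi : 'rV[R]_p -> R)
  : 'rV[R]_p -> R := fun x => 'D_(delta_mx ord0 i) phi x.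

Definition grad (R : realType) (p : nat) (phi : 'rV[R]_p -> R) (x : 'rV[R]_p)
  : 'rV[R]_p := \row_(i < p) partial i phi x.

Definition smooth (R : realType) (p : nat) (phi : 'rV[R]_p -> R) : Prop :=
  forall (s : seq 'I_p) (x : 'rV[R]_p),
    differentiable (foldr (@partial R p) phi s) x.

Definition test_function (R : realType) (p : nat) (phi : 'rV[R]_p -> R)
  : Prop :=
  smooth phi /\ compact (closure [set x | phi x != 0]).

(* The distribution div(rho v) tested against phi: the gradient is moved onto
   phi. *)
Definition weak_div (R : realType) (p : nat) (Omega : set 'rV[R]_p)
  (Omega0 : Omega !=set0) (rho : Pr2 Omega0) (v : domain Omega0 -> 'rV[R]_p)
  (phi : 'rV[R]_p -> R) : \bar R :=
  (- \int[rho]_t (dotr (grad phi (dval t)) (v t))%:E)%E.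

(* Right-hand sides at rho of the Wasserstein gradient flows minimizing and
   maximizing F, when g is the gradient of the first variation of F at rho. *)
Definition wgf_min_rhs (R : realType) (p : nat) (Omega : set 'rV[R]_p)
  (Omega0 : Omega !=set0) (rho : Pr2 Omega0) (g : domain Omega0 -> 'rV[R]_p)
  (phi : 'rV[R]_p -> R) : \bar R := weak_div rho g phi.

Definition wgf_max_rhs (R : realType) (p : nat) (Omega : set 'rV[R]_p)
  (Omega0 : Omega !=set0) (rho : Pr2 Omega0) (g : domain Omega0 -> 'rV[R]_p)
  (phi : 'rV[R]_p -> R) : \bar R := (- weak_div rho g phi)%E.

Definition wgf_min_stationary (R : realType) (p : nat)
  (Omega : set 'rV[R]_p) (Omega0 : Omega !=set0) (rho : Pr2 Omega0)
  (g : domain Omega0 -> 'rV[R]_p) : Prop :=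
  forall phi, test_function phi -> wgf_min_rhs rho g phi = 0%E.

Definition wgf_max_stationary (R : realType) (p : nat)
  (Omega : set 'rV[R]_p) (Omega0 : Omega !=set0) (rho : Pr2 Omega0)
  (g : domain Omega0 -> 'rV[R]_p) : Prop :=
  forall phi, test_function phi -> wgf_max_rhs rho g phi = 0%E.

(* Main.v *)
(* The integrand defining the weak divergence vanishes on the support of rho, and
   the complement of the support is null: it is covered by the null traces on
   Omega of the balls of rational center and radius 1/(n+1), of which there are
   countably many. *)
Require Import Defs.
From mathcomp Require Import all_boot all_order all_algebra.
From mathcomp Require Import all_classical all_reals all_analysis.

Import Order.TTheory GRing.Theory Num.Theory.
Import numFieldNormedType.Exports.
Import HBNNSimple.

Local Open Scope classical_set_scope.
Local Open Scope ring_scope.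

(* The gradient may be nonmeasurable off the support, so the library's lemmas on
   a.e. equal integrands do not apply; but every simple function below [f]
   already vanishes off a null set. *)
Lemma ge0_ae_eq0_integral d (T : measurableType d) (R : realType)
    (mu : {measure set T -> \bar R}) (D : set T) (f : T -> \bar R) :
  (forall x, 0 <= f x)%E -> {ae mu, forall x, D x -> f x = 0%E} ->
  (\int[mu]_(x in D) f x = 0)%E.
Proof.
move=> f0 [N [mN muN0 fN]].
apply/eqP; rewrite eq_le integral_ge0 ?andbT//.
rewrite ge0_integralE//; apply: ge_ereal_sup => /= _ [h hf <-].
rewrite sintegralET fsbig1// => r _.
(* Only fibres of [h] over nonzero values matter, and they lie in [N]: off [N] the restriction of
   [f] to [D] is zero, which squeezes [h] to zero. *)
have [->|r0] := eqVneq r 0; first by rewrite mul0e.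
rewrite (_ : mu _ = 0%E) ?mule0//.
apply: (subset_measure0 _ mN _ muN0) => [|x /= hxr].
  exact: measurable_funPTI (measurable_set1 r).
apply: fN => /= fx0.
have := hf x; have hx : 0 <= h x by [].
rewrite /patch; case: ifPn => [/set_mem /fx0 ->|_];
  by rewrite lee_fin => hx0; move/eqP: r0; apply; rewrite -hxr;
     apply/eqP; rewrite eq_le hx0.
Qed.

(** The positive and negative parts vanish wherever [f] does, so the nonnegative case applies to
    each. *)
Lemma ae_eq0_integral d (T : measurableType d) (R : realType)
    (mu : {measure set T -> \bar R}) (D : set T) (f : T -> \bar R) :
  {ae mu, forall x, D x -> f x = 0%E} -> (\int[mu]_(x in D) f x = 0)%E.
Proof.
move=> f0; rewrite integralE !ge0_ae_eq0_integral ?sube0//.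
- by apply: filterS f0 => x fx0 /fx0; rewrite funenegE => ->; rewrite oppe0 maxxx.
- by apply: filterS f0 => x fx0 /fx0; rewrite funeposE => ->; rewrite maxxx.
Qed.

(** Balls of ['rV[R]_p] are taken coordinatewise, so density of the rationals in each coordinate
    suffices. *)
Lemma rat_rV_dense (R : realType) (p : nat) (x : 'rV[R]_p) (e : R) :
  0 < e -> exists q : 'rV[rat]_p, ball (map_mx ratr q : 'rV[R]_p) e x.
Proof.
move=> e0.
have /choice[q qP] (i : 'I_p) : exists q : rat, ball (ratr q : R) e (x ord0 i).
  have /rat_in_itvoo[q] : x ord0 i - e < x ord0 i + e.
    by rewrite ltrBlDr -addrA ltrDl addr_gt0.
  rewrite in_itv /= => qx; exists q.
  by rewrite -ball_normE /ball_ /= -ltr_distlC distrC in qx *.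
exists (\row_i q i); split=> // i j.
by rewrite !mxE ord1.
Qed.

Lemma msupp_ae (R : realType) (p : nat) (Omega : set 'rV[R]_p)
    (Omega0 : Omega !=set0) (rho : Pr2 Omega0) :
  {ae rho, forall t, msupp rho t}.
Proof.
(* Passing to the interior of the ball makes each trace open by construction, hence Borel. *)
pose B (u : 'rV[rat]_p * nat) : set (domain Omega0) :=
  @dval R p Omega Omega0 @^-1` (ball (map_mx ratr u.1 : 'rV[R]_p) u.2.+1%:R^-1)°.
have oB u : open (B u).
  by exists (ball (map_mx ratr u.1 : 'rV[R]_p) u.2.+1%:R^-1)°; first exact: open_interior.
have mB u : measurable (B u) by exact: sub_sigma_algebra.
(* The null traces, enumerated by the codes of their indices; a trace of positive measure, or a
   number coding no index, contributes the empty set. *)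
pose C k : set (domain Omega0) :=
  if unpickle k is Some u then [set t | B u t /\ rho (B u) = 0%E] else set0.
apply: (@negligibleS _ _ _ _ (\bigcup_k C k)) => [t /= |]; last first.
  apply: negligible_bigcup => k; rewrite /C.
  case: unpickle => [u|]; last exact: negligible_set0.
  have [B0|B0] := pselect (rho (B u) = 0%E).
    by exists (B u); split => // t [].
  by exists set0; split => // t [].
move=> /existsNP[U /not_implyP[oU /not_implyP[Ut /negP rhoU]]].
have {}rhoU : rho U = 0%E.
  by apply/eqP; rewrite eq_le measure_ge0 andbT leNgt.
have [V oV VU] := oU.
have : nbhs (dval t) V.
  by apply: open_nbhs_nbhs; split => //; move: Ut; rewrite -VU.
move=> /nbhs_ballP[e /= e0 eV].
(* With [r < e / 2] and [q] within [r / 2] of [t], the ball of radius [r] about [q] stays within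
   [r / 2 + r <= e] of [t], hence inside [V]. *)
have [n] : exists n, n.+1%:R^-1 < e / 2.
  have /ltr_add_invr[n] : 0 < e / 2 by rewrite divr_gt0.
  by rewrite add0r => ne; exists n.
set r := n.+1%:R^-1 => re.
have r0 : 0 < r by rewrite invr_gt0.
have r20 : 0 < r / 2 by rewrite divr_gt0.
have [q qt] := rat_rV_dense R p (dval t) _ r20.
have BU : B (q, n) `<=` U.
  move=> s /interior_subset qs; rewrite -VU; apply: eV.
  apply: (@le_ball _ _ _ (r / 2 + r)).
    rewrite [leRHS]splitr lerD ?ltW// (le_lt_trans _ re)//.
    by rewrite ler_pdivrMr// ler_peMr ?ler1n// ltW.
  exact: ball_triangle (ball_sym qt) qs.
(* The choice of [r / 2] also leaves room for a ball of radius [r / 2] about [t], so [t] is interior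
   to the ball about [q]. *)
exists (pickle (q, n)) => //; rewrite /C pickleK; split.
  apply: filterS (nbhsx_ballx _ _ r20) => s ts /=.
  by rewrite -/r [r]splitr; exact: ball_triangle qt ts.
by apply: (subset_measure0 _ _ BU rhoU) => //; exact: sub_sigma_algebra.
Qed.

Theorem lemma4p1 (R : realType) (p : nat) (Omega : set 'rV[R]_p)
  (Omega0 : Omega !=set0) (F : Pr2 Omega0 -> R) (rho : Pr2 Omega0)
  (dF : domain Omega0 -> R) (graddF : domain Omega0 -> 'rV[R]_p)
  (dF_variation : is_first_variation F rho dF)
  (dF_gradient : is_gradient dF graddF)
  (critical : forall t, msupp rho t -> graddF t = 0) :
  wgf_min_stationary rho graddF /\
  wgf_max_stationary rho graddF.
Proof.
(* The two right-hand sides differ only by a sign, so this settles both flows. *)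
have weak_div0 phi : weak_div rho graddF phi = 0%E.
  rewrite /weak_div ae_eq0_integral ?oppe0//.
  apply: filterS (msupp_ae _ _ _ _ rho) => t /critical -> _.
  by rewrite /dotr big1// => i _; rewrite [X in _ * X]mxE mulr0.
split=> phi _; first exact: weak_div0.
by rewrite /wgf_max_rhs weak_div0 oppe0.
Qed.
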